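(* Let $\{M_p\}_{p\in\mathbb{N}}$ be a sequence of positive real numbers and let $\ast$ stand for $(M_p)$ (Beurling case) or $\{M_p\}$ (Roumieu case). Any element $f\in\mathcal{K}'^{\ast}(\mathbb{R}^{d})$ satisfies the moment asymptotic expansion (MAE) in $\mathcal{K}'^{\ast}(\mathbb{R}^{d})$, and its moments are exactly $\mu_\alpha=\langle f(x),x^{\alpha}\rangle$, $\alpha\in\mathbb{N}^{d}$.
   Context: $0\in\mathbb{N}$, and $M_\alpha:=M_{|\alpha|}$ for $\alpha\in\mathbb{N}^d$. No condition on the weight sequence is imposed beyond positivity. The space $\mathcal{K}^{\ast}(\mathbb{R}^d)$. For $q\in\mathbb{N}$ and $\ell>0$, $\mathcal{K}^{M_p,\ell}_q(\mathbb{R}^d)$ is the Banach space of all smooth functions $\varphi$ on $\mathbb{R}^d$ for which $$\|\varphi\|_{\mathcal{K}^{M_p,\ell}_q(\mathbb{R}^d)}=\sup_{\alpha\in\mathbb{N}^d}\sup_{x\in\mathbb{R}^d}\frac{(1+|x|)^{|\alpha|-q}|\varphi^{(\alpha)}(x)|}{\ell^{|\alpha|}M_\alpha}<\infty.$$ Then $\mathcal{K}^{(M_p)}_q(\mathbb{R}^d)=\varprojlim_{\ell\to0^+}\mathcal{K}^{M_p,\ell}_q(\mathbb{R}^d)$, $\mathcal{K}^{\{M_p\}}_q(\mathbb{R}^d)=\varinjlim_{\ell\to\infty}\mathcal{K}^{M_p,\ell}_q(\mathbb{R}^d)$, and $\mathcal{K}^{\ast}(\mathbb{R}^d)=\varinjlim_{q\in\mathbb{N}}\mathcal{K}^{\ast}_q(\mathbb{R}^d)$.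 This space contains all polynomials; $\mathcal{K}'^{\ast}(\mathbb{R}^d)$ is its dual. MAE. Let $\mathcal{X}$ be a locally convex space of smooth functions on $\mathbb{R}^d$ on which the dilation operators and the Dirac delta and all its partial derivatives act continuously. An element $f\in\mathcal{X}'$ satisfies the moment asymptotic expansion (MAE) in $\mathcal{X}'$ if there are $\mu_\alpha\in\mathbb{C}$, $\alpha\in\mathbb{N}^d$, called its moments, such that for any $\varphi\in\mathcal{X}$ and $k\in\mathbb{N}$ $$\langle f(\lambda x),\varphi(x)\rangle=\sum_{|\alpha|<k}\frac{\mu_\alpha\varphi^{(\alpha)}(0)}{\alpha!\,\lambda^{|\alpha|+d}}+O\!\left(\frac1{\lambda^{k+d}}\right),\qquad\lambda\to\infty,$$ where $\langle f(\lambda x),\varphi(x)\rangle=\lambda^{-d}\langle f(x),\varphi(x/\lambda)\rangle$. *)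

(* Defs.v *)
From mathcomp Require Import all_boot all_order all_algebra.
From mathcomp Require Import all_classical all_reals all_analysis.
From mathcomp Require Export complex.

Set Implicit Arguments.
Unset Strict Implicit.
Unset Printing Implicit Defensive.

Import Order.TTheory GRing.Theory Num.Theory.
Import numFieldNormedType.Exports.

Local Open Scope classical_set_scope.
Local Open Scope ring_scope.
Local Open Scope complex_scope.

Definition multi_index (d : nat) := {ffun 'I_d -> nat}.

Section MultiIndex.
Context {d : nat}.
Implicit Types a : multi_index d.

Definition mabs a : nat := (\sum_i a i)%N.

Definition mfact a : nat := (\prod_i (a i)`!)%N.

(* Every multi-index of length < k has all its entries < k, so sums over
   |a| < k are taken over those a in {ffun 'I_d -> 'I_k} with mabs a < k. *)
Definition mval k (a : {ffun 'I_d -> 'I_k}) : multi_index d :=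
  [ffun i => nat_of_ord (a i)].

End MultiIndex.

Section Functions.
Context {R : realType} {d : nat}.

Definition cfun := 'rV[R]_d -> R[i].

(* The norm of 'rV[R]_d in the library is the sup norm. *)
Definition enorm (x : 'rV[R]_d) : R := Num.sqrt (\sum_i x 0 i ^+ 2).

Implicit Type phi : cfun.

(* The library's derivative is for maps between normed modules over the same
   field, hence the real and imaginary parts are differentiated separately. *)
Definition pderiv (i : 'I_d) phi : cfun := fun x =>
  ('D_(delta_mx 0 i) (fun y => complex.Re (phi y)) x) +i*
  ('D_(delta_mx 0 i) (fun y => complex.Im (phi y)) x).

Definition pderivable phi : Prop := forall (x : 'rV[R]_d) (i : 'I_d),
  derivable (fun y => complex.Re (phi y)) x (delta_mx 0 i) /\
  derivable (fun y => complex.Im (phi y)) x (delta_mx 0 i).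

Definition ccontinuous phi : Prop :=
  continuous (fun y => complex.Re (phi y)) /\
  continuous (fun y => complex.Im (phi y)).

Definition smooth phi : Prop := forall s : seq 'I_d,
  pderivable (foldr pderiv phi s) /\ ccontinuous (foldr pderiv phi s).

Definition mderiv (a : multi_index d) phi : cfun :=
  foldr (fun i => iter (a i) (pderiv i)) phi (enum 'I_d).

Definition monomial (a : multi_index d) : cfun :=
  fun x => (\prod_i x 0 i ^+ a i)%:C.

(* phi |-> phi (x / lambda) *)
Definition dilate (lambda : R) phi : cfun := fun x => phi (lambda^-1 *: x).

End Functions.
Arguments cfun : clear implicits.

Section LocallyConvex.
Context {R : realType} {E : lmodType R[i]}.

(* A linear subspace of E with a vector space topology, the latter given by
   its neighbourhoods of 0.  A neighbourhood is a subset of E, of which only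
   the trace on the carrier matters. *)
Record lcspace := LCSpace {
  carrier : set E;
  nbhs0 : set_system E
}.

(* {phi in D | N phi < +oo} with the topology of the norm N *)
Definition normed_space (D : set E) (N : E -> \bar R) : lcspace := {|
  carrier := [set phi | D phi /\ (N phi < +oo)%E];
  nbhs0 := [set U | exists2 e : R, 0 < e &
              [set phi | D phi /\ (N phi < e%:E)%E] `<=` U]
|}.

Definition abs_convex (V : set E) : Prop :=
  forall (phi psi : E) (a b : R[i]), V phi -> V psi -> `|a| + `|b| <= 1 ->
    V (a *: phi + b *: psi).

(* The limits below are taken along inclusions of subspaces of E. *)

(* the coarsest topology on the intersection making the inclusions into the
   X i continuous *)
Definition proj_limit (I : eqType) (X : I -> lcspace) : lcspace := {|
  carrier := \bigcap_i carrier (X i);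
  nbhs0 := [set U | exists (s : seq I) (V : I -> set E),
              (forall i, i \in s -> nbhs0 (X i) (V i)) /\
              (\bigcap_i carrier (X i)) `&` (\bigcap_(i in [set` s]) V i)
                `<=` U]
|}.

(* the finest locally convex topology on the union making the inclusions of
   the X i continuous *)
Definition ind_limit (I : Type) (X : I -> lcspace) : lcspace := {|
  carrier := \bigcup_i carrier (X i);
  nbhs0 := [set U | exists V : set E,
              [/\ V `<=` \bigcup_i carrier (X i), abs_convex V,
                  forall i, nbhs0 (X i) V & V `<=` U]]
|}.

(* f represents an element of the dual of X; its values outside carrier X are
   irrelevant. *)
Definition in_dual (X : lcspace) (f : E -> R[i]) : Prop :=
  (forall (a : R[i]) (phi psi : E), carrier X phi -> carrier X psi ->
     f (a *: phi + psi) = a * f phi + f psi) /\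
  (forall phi : E, carrier X phi ->
     (fun psi => f (phi + psi) : R[i]^o) @ within (carrier X) (nbhs0 X)
       --> (f phi : R[i]^o)).

End LocallyConvex.
Arguments lcspace {R} E.

Inductive uclass := Beurling | Roumieu.

Section SpacesK.
Context {R : realType} (d : nat) (M : nat -> R).

Definition Knorm (l : R) (q : nat) (phi : cfun R d) : \bar R :=
  ereal_sup [set r | exists (a : multi_index d) (x : 'rV[R]_d),
    r = ((1 + enorm x) ^ ((mabs a)%:Z - q%:Z) *
           ComplexField.Normc.normc (mderiv a phi x) /
         (l ^+ mabs a * M (mabs a)))%:E].

Definition Kql (q : nat) (l : R) : lcspace (cfun R d) :=
  normed_space smooth (Knorm l q).

Definition Kq (c : uclass) (q : nat) : lcspace (cfun R d) :=
  match c with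
  | Beurling => proj_limit (fun l : {posnum R} => Kql q l%:num)
  | Roumieu => ind_limit (fun l : {posnum R} => Kql q l%:num)
  end.

Definition Kspace (c : uclass) : lcspace (cfun R d) := ind_limit (Kq c).

End SpacesK.

Section MomentAsymptoticExpansion.
Context {R : realType} {d : nat}.
Implicit Types (X : lcspace (cfun R d)) (f : cfun R d -> R[i]).

(* <f(lambda x), phi(x)> *)
Definition dilate_dual f (lambda : R) (phi : cfun R d) : R[i] :=
  (lambda ^- d)%:C * f (dilate lambda phi).

Definition has_moments X f (mu : multi_index d -> R[i]) : Prop :=
  forall (phi : cfun R d) (k : nat), carrier X phi ->
    exists C : R, \forall lambda \near +oo,
      `| dilate_dual f lambda phi -
         \sum_(a : {ffun 'I_d -> 'I_k} | (mabs (mval a) < k)%N)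
           mu (mval a) * mderiv (mval a) phi 0 /
             ((mfact (mval a))%:R * (lambda ^+ (mabs (mval a) + d))%:C) |
      <= (C / lambda ^+ (k + d))%:C.

Definition satisfies_MAE X f : Prop := exists mu, has_moments X f mu.

End MomentAsymptoticExpansion.

(* Main.v *)
(* Given phi in K_q, enlarge q so that k <= q, and let psi be phi minus its
   Taylor polynomial of degree < k at 0.  The derivatives of psi of order >= k
   are those of phi; those of order n < k are O(|y|^(k-n) (1+|y|)^(q-k)) by the
   mean value theorem.  Hence lambda^k psi(x/lambda), lambda >= 1, is bounded in
   the same space K_q^{M,l} as phi, and a continuous functional is bounded on
   bounded sets, so <f, psi(x/lambda)> = O(lambda^-k); by homogeneity, the Taylor
   polynomial contributes exactly the terms of the expansion.  The moments are
   determined by applying the expansion of order |a|+1 to the monomial x^a. *)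
Require Import Defs.
From mathcomp Require Import all_boot all_order all_algebra.
From mathcomp Require Import all_classical all_reals all_analysis.
From mathcomp Require Import complex ring.
Import Order.TTheory GRing.Theory Num.Theory.
Import numFieldNormedType.Exports.
Local Open Scope ring_scope.
Local Open Scope classical_set_scope.
Local Open Scope complex_scope.

(** * Directional derivatives *)

(** The estimate of the dilated remainder leaves both [l] and [q] unchanged: orders at least k keep
    the constant of phi, and the finitely many orders below k add a finite sum. One estimate at
    fixed [l] therefore serves the Beurling class (every [l]) and the Roumieu class (some [l]). The
    delicate orders are n > q, where the weight has a negative exponent and grows under dilation;
    there lambda^(k-n) (1 + |x|/lambda)^(q-n) = lambda^(k-q) (lambda + |x|)^(q-n), and k <= q
    absorbs the remaining power of lambda. Smoothness is given through iterated partial derivatives,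
    so all calculus runs along coordinate lines. The norm sees each derivative only in the order of
    directions fixed by [mderiv], whereas the Taylor estimate meets directions in arbitrary order;
    hence the need for symmetry of mixed partial derivatives. *)

Section Directional.
Context {R : realType} {V : normedModType R}.
Implicit Types (f : V -> R) (x u v w : V).

(** Both difference quotients are the same function of the increment. This brings the one-variable
    chain rule and mean value theorem to bear on directional derivatives. *)
Lemma is_derive_lineE f x v t (df : R) :
  is_derive (x + t *: v) v f df <->
  is_derive t (1 : R) (fun s : R => f (x + s *: v)) df.
Proof.
have E : (fun h : R => h^-1 *: ((f \o shift (x + t *: v)) (h *: v)
                        - f (x + t *: v))) =
         (fun h : R => h^-1 *: (((fun s : R => f (x + s *: v)) \o shift t)
                        (h *: (1 : R)) - f (x + t *: v))).
  apply/funext => h /=; congr (_ *: (f _ - _)).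
  by rewrite [_ *: 1]mulr1 scalerDl addrCA.
by split=> -[D <-]; split; rewrite ?/derivable ?/derive (E, esym E).
Qed.

Lemma is_derive_shift f x v w (df : R) :
  is_derive (x + w) v f df -> is_derive x v (fun y => f (y + w)) df.
Proof.
have E : (fun h : R => h^-1 *: ((f \o shift (x + w)) (h *: v) - f (x + w))) =
         (fun h : R => h^-1 *: (((fun y => f (y + w)) \o shift x) (h *: v)
                        - f (x + w))).
  by apply/funext => h /=; rewrite addrA.
by case=> D <-; split; rewrite ?/derivable ?/derive -E.
Qed.

Lemma is_derive_dilate f x v (c df : R) :
  is_derive (c *: x) v f df ->
  is_derive x v (fun y => f (c *: y)) (df * c).
Proof.
(* The parameter is written c * 0 so that it is the value at 0 of the inner map s -> c * s in the
   chain rule. *)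
move=> D; have {D} : is_derive (c *: x + (c * 0) *: v) v f df.
  by rewrite mulr0 scale0r addr0.
move/is_derive_lineE => D.
have -> : x = x + (0 : R) *: v by rewrite scale0r addr0.
apply/is_derive_lineE.
have -> : (fun s : R => f (c *: (x + s *: v))) =
    (fun s : R => f (c *: x + s *: v)) \o (fun s : R => c * s).
  by apply/funext => s /=; rewrite scalerDr scalerA.
apply: is_derive1_comp.
have := @is_deriveZ R R R id c (0 : R) 1 1 (is_derive_id _ _).
by rewrite [_ *: _]mulr1.
Qed.

(** The segment is reparametrised by [0, 1], so that t may have either sign. *)
Lemma MVT_line f x v (t : R) : (forall y, derivable f y v) ->
  exists2 a : R, 0 <= a <= 1 &
    f (x + t *: v) - f x = t * 'D_v f (x + (a * t) *: v).
Proof.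
move=> df; pose g (s : R) := f (x + (t * s) *: v).
have dg (s : R) : is_derive s 1 g ('D_v f (x + (t * s) *: v) * t).
  apply: (@is_derive1_comp _ (fun s => f (x + s *: v)) (fun s => t * s)).
    exact/is_derive_lineE/derivableP.
  have := @is_deriveZ R R R id t s 1 1 (is_derive_id _ _).
  by rewrite [_ *: _]mulr1.
have [|a] := @MVT_segment R g (fun s => 'D_v f (x + (t * s) *: v) * t) 0 1 ler01
  (fun s _ => dg s).
  by apply: derivable_within_continuous => s _; case: (dg s).
rewrite in_itv /= => a01.
rewrite /g mulr0 mulr1 scale0r addr0 subr0 mulr1 => E.
by exists a => //; rewrite (mulrC a) E [LHS]mulrC.
Qed.

(** A second difference is the increment along u of an increment along v, so the mean value theorem
    applies once in each direction. *)
Lemma second_difference f x u v (t : R) :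
  (forall y, derivable f y u) -> (forall y, derivable ('D_u f) y v) ->
  exists a b : R, [/\ 0 <= a <= 1, 0 <= b <= 1 &
    f (x + t *: u + t *: v) - f (x + t *: u) - (f (x + t *: v) - f x) =
    t * (t * 'D_v ('D_u f) (x + (a * t) *: u + (b * t) *: v))].
Proof.
move=> du dv; pose g y := f (y + t *: v) - f y.
have dg y : is_derive y u g ('D_u f (y + t *: v) - 'D_u f y).
  by apply: is_deriveB; [apply: is_derive_shift|]; exact: derivableP.
have [a a01 Ea] := @MVT_line g x u t (fun y => @ex_derive _ _ _ _ _ _ _ (dg y)).
have [b b01 Eb] := @MVT_line ('D_u f) (x + (a * t) *: u) v t dv.
exists a, b; split => //.
by rewrite -[LHS]/(g (x + t *: u) - g x) Ea (@derive_val _ _ _ _ _ _ _ (dg _)) Eb.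
Qed.

(* Both iterated derivatives, taken at points near [x], equal the second
   difference of [f] divided by [t ^ 2]. *)
Lemma derive_comm f x u v :
  (forall y, derivable f y u) -> (forall y, derivable f y v) ->
  (forall y, derivable ('D_u f) y v) -> (forall y, derivable ('D_v f) y u) ->
  {for x, continuous ('D_v ('D_u f))} -> {for x, continuous ('D_u ('D_v f))} ->
  'D_v ('D_u f) x = 'D_u ('D_v f) x.
Proof.
move=> du dv duv dvu cuv cvu.
apply/eqP; rewrite -subr_eq0 -normr_le0; apply/ler_addgt0Pl => e e0.
rewrite addr0.
have e2 : 0 < e / 2 by rewrite divr_gt0.
have /cvgr_dist_lt/(_ _ e2)/nbhs_ballP[r1 r10 H1] := cuv.
have /cvgr_dist_lt/(_ _ e2)/nbhs_ballP[r2 r20 H2] := cvu.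
pose r := Num.min r1 r2.
have r0 : 0 < r by rewrite lt_min r10.
(* Both intermediate points lie within t * N of x, since their coefficients are at most t; the
   summand 1 keeps N positive when u = v = 0. *)
pose N := `|u| + `|v| + 1.
have N0 : 0 < N by rewrite ltr_wpDl// addr_ge0.
have [t t0 tN] : exists2 t : R, 0 < t & t * N < r.
  exists (r / 2 / N); first by rewrite !divr_gt0.
  by rewrite divfK ?gt_eqF// ltr_pdivrMr// ltr_pMr// ltr1n.
have close a b u' v' : 0 <= a <= 1 -> 0 <= b <= 1 -> `|u'| + `|v'| + 1 = N ->
    ball x r (x + (a * t) *: u' + (b * t) *: v').
  move=> /andP[a0 a1] /andP[b0 b1] EN.
  rewrite -ball_normE /ball_ /= -addrA opprD addNKr normrN.
  apply: le_lt_trans tN; apply: le_trans (ler_normD _ _) _.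
  rewrite !normrZ ?normrM !(ger0_norm a0, ger0_norm b0, gtr0_norm t0).
  apply: (@le_trans _ _ (t * `|u'| + t * `|v'|)).
    by apply: lerD; apply: ler_wpM2r => //; apply: ler_piMl => //; exact: ltW.
  by rewrite -EN -mulrDr ler_pM2l// lerDl.
have [a [b [a01 b01 E1]]] := @second_difference f x u v t du duv.
have [a' [b' [a'01 b'01 E2]]] := @second_difference f x v u t dv dvu.
have E : 'D_v ('D_u f) (x + (a * t) *: u + (b * t) *: v) =
         'D_u ('D_v f) (x + (a' * t) *: v + (b' * t) *: u).
  apply: (mulfI (lt0r_neq0 t0)); apply: (mulfI (lt0r_neq0 t0)).
  apply: etrans (esym E1) (etrans _ E2); rewrite (addrAC x (t *: v)).
  set p := f _; set q := f _; set s := f _; set w := f _.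
  by rewrite !opprB !addrA; ring.
have := H1 _ (le_ball _ (close _ _ u v a01 b01 erefl)).
have := H2 _ (le_ball _ (close _ _ v u a'01 b'01 _)).
rewrite !ge_min !lexx orbT -E [`|v| + _]addrC => /(_ isT erefl) h2 /(_ isT) h1.
rewrite (splitr e); apply: le_trans (lerD (ltW h1) (ltW h2)).
rewrite [X in _ <= _ + X]distrC.
apply: le_trans (ler_normD _ _).
by rewrite addrA subrK.
Qed.

End Directional.

(** * Iterated partial derivatives *)

Section RealSmooth.
Context {R : realType} {d : nat}.
Implicit Types (g h : 'rV[R]_d -> R) (s : seq 'I_d) (x y : 'rV[R]_d).

Definition rderiv (i : 'I_d) g : 'rV[R]_d -> R := 'D_(delta_mx 0 i) g.

Definition rderivs s g := foldr rderiv g s.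

Definition rsmooth g := forall s,
  (forall x i, derivable (rderivs s g) x (delta_mx 0 i)) /\
  continuous (rderivs s g).

(** The first letter of s is located in t and carried to the front by adjacent transpositions, each
    an instance of [derive_comm]. *)
Lemma rderivs_perm g s t : rsmooth g -> perm_eq s t -> rderivs s g = rderivs t g.
Proof.
move=> gs; elim: s t => [|i s IH] t; first by rewrite perm_sym => /perm_nilP ->.
move=> st; have it : i \in t by rewrite -(perm_mem st) mem_head.
case/splitPr: it st => t1 t2; rewrite perm_sym perm_catC cat_cons perm_cons.
rewrite perm_catC perm_sym => /IH /= ->.
elim: t1 => [//|j t1 IH1] /=; rewrite -IH1.
have d0 := (gs (t1 ++ t2)).1.
have dj := (gs (j :: t1 ++ t2)).1; have di := (gs (i :: t1 ++ t2)).1.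
have cij := (gs [:: i, j & t1 ++ t2]).2; have cji := (gs [:: j, i & t1 ++ t2]).2.
apply/funext => x.
exact: (derive_comm (rderivs (t1 ++ t2) g) x (delta_mx 0 j) (delta_mx 0 i)
  (d0^~ j) (d0^~ i) (dj^~ i) (di^~ j) (cij x) (cji x)).
Qed.

Lemma rderivs_cst0 s : rderivs s (cst 0) = cst 0 :> ('rV[R]_d -> R).
Proof.
elim: s => [//|i s /= ->]; apply/funext => x; exact: derive_cst.
Qed.

Lemma rsmooth_cst0 : rsmooth (cst 0 : 'rV[R]_d -> R).
Proof.
by move=> s; rewrite rderivs_cst0; split=> [x i|x];
  [exact: derivable_cst|exact: cst_continuous].
Qed.

Lemma rderivs_lin (a : R) g h s : rsmooth g -> rsmooth h ->
  rderivs s (fun x => a * g x + h x) = (fun x => a * rderivs s g x + rderivs s h x).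
Proof.
move=> gs hs; elim: s => [//|i s /= ->]; apply/funext => x.
have /derivableP dg := (gs s).1 x i; have /derivableP dh := (hs s).1 x i.
have D := is_deriveD (is_deriveZ a dg) dh.
exact: (@derive_val _ _ _ _ _ _ _ D).
Qed.

Lemma rsmooth_lin (a : R) g h : rsmooth g -> rsmooth h ->
  rsmooth (fun x => a * g x + h x).
Proof.
move=> gs hs s; rewrite rderivs_lin//; have [dg cg] := gs s; have [dh ch] := hs s.
split=> [x i|x]; last first.
  exact: (continuousD (continuousM (@cst_continuous _ _ a x) (cg x)) (ch x)).
have D := is_deriveD (is_deriveZ a (derivableP (dg x i))) (derivableP (dh x i)).
exact: (@ex_derive _ _ _ _ _ _ _ D).
Qed.

Lemma rderivs_dilate (c : R) g s : rsmooth g ->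
  rderivs s (fun x => g (c *: x)) = (fun x => c ^+ size s * rderivs s g (c *: x)).
Proof.
move=> gs; elim: s => [|i s /= ->]; first by apply/funext => x /=; rewrite mul1r.
apply/funext => x.
have D := is_derive_dilate _ _ _ _ _ (derivableP ((gs s).1 (c *: x) i)).
have {}D := is_deriveZ (c ^+ size s) D.
rewrite exprSr -mulrA [c * _]mulrC.
exact: (@derive_val _ _ _ _ _ _ _ D).
Qed.

Lemma rsmooth_dilate (c : R) g : rsmooth g -> rsmooth (fun x => g (c *: x)).
Proof.
move=> gs s; rewrite rderivs_dilate//; have [dg cg] := gs s; split=> [x i|x].
  have D := is_derive_dilate _ _ _ _ _ (derivableP (dg (c *: x) i)).
  have {}D := is_deriveZ (c ^+ size s) D.
  exact: (@ex_derive _ _ _ _ _ _ _ D).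
apply: (continuousM (@cst_continuous _ _ (c ^+ size s) x)).
by apply: continuous_comp; [exact: scaler_continuous|exact: cg].
Qed.

Definition rmonomial (a : multi_index d) : 'rV[R]_d -> R :=
  fun x => \prod_i x 0 i ^+ a i.

(* Where the subtraction truncates, the coefficient in [rderivs_rmonomial]
   vanishes. *)
Definition mdiffcount (a : multi_index d) s : multi_index d :=
  [ffun i => (a i - count_mem i s)%N].

Lemma is_derive_rmonomial a x i : is_derive x (delta_mx 0 i) (rmonomial a)
  ((a i)%:R * rmonomial (mdiffcount a [:: i]) x).
Proof.
have -> : x = x + (0 : R) *: delta_mx 0 i by rewrite scale0r addr0.
apply/is_derive_lineE.
(* Along a line in direction i only the i-th factor varies, so the monomial becomes q times a
   one-variable power. *)
set q := \prod_(j | j != i) x 0 j ^+ a j.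
have coordE (t : R) j : (x + t *: delta_mx 0 i) 0 j = x 0 j + t * (j == i)%:R.
  by rewrite !mxE eqxx.
have -> : (fun s : R => rmonomial a (x + s *: delta_mx 0 i)) =
          (fun s : R => q * (x 0 i + s) ^+ a i).
  apply/funext => s; rewrite /rmonomial (bigD1 i)//= mulrC; congr (_ * _).
    by apply: eq_bigr => j ji; rewrite coordE (negPf ji) mulr0 addr0.
  by rewrite coordE eqxx mulr1.
have -> : rmonomial (mdiffcount a [:: i]) (x + 0 *: delta_mx 0 i) =
          q * x 0 i ^+ (a i).-1.
  rewrite scale0r addr0 /rmonomial (bigD1 i)//= mulrC; congr (_ * _).
    apply: eq_bigr => j ji; rewrite ffunE /= eq_sym (negPf ji) addn0 subn0//.
  by rewrite ffunE /= eqxx addn0 subn1.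
have D1 : is_derive (0 : R) (1 : R) (fun t : R => x 0 i + t) (1 : R).
  have := is_deriveD (is_derive_cst (x 0 i : R) (0 : R) (1 : R)) (is_derive_id (0 : R) (1 : R)).
  by rewrite add0r.
have D2 := is_deriveZ q (is_deriveX (a i) D1).
rewrite (_ : (fun t : R => _) = q *: (fun t : R => x 0 i + t) ^+ a i); last first.
  by apply/funext => t; rewrite [RHS]/(q * _) exprfctE.
apply: (is_derive_eq D2).
by rewrite addr0 [_ *: 1]mulr1 [LHS]mulrCA.
Qed.

Lemma continuous_rmonomial a : continuous (rmonomial a).
Proof.
apply: (@continuous_big R 'I_d *%R 1 xpredT (@mul_continuous R) _ _
  (fun i (y : 'rV[R]_d) => y 0 i ^+ a i)) => i _ x.
apply: (@continuous_comp _ _ _ (fun y : 'rV[R]_d => y 0 i) (fun r : R => r ^+ a i)).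
  exact: coord_continuous.
exact: exprn_continuous.
Qed.

Lemma rderivs_rmonomial a s : rderivs s (rmonomial a) =
  (fun x => (\prod_i (a i ^_ count_mem i s))%N%:R * rmonomial (mdiffcount a s) x).
Proof.
elim: s => [|i s /= ->]; apply/funext => x.
  rewrite big1 ?mul1r => [|i _]; last by rewrite ffactn0.
  by congr rmonomial; apply/ffunP => i; rewrite ffunE subn0.
set n := (\prod_j _)%N.
have D := is_deriveZ n%:R (is_derive_rmonomial (mdiffcount a s) x i).
rewrite [LHS](@derive_val _ _ _ _ _ _ _ D) [_ *: _]mulrA -natrM.
congr (_%:R * rmonomial _ x).
  rewrite /n (bigD1 i)//= [in RHS](bigD1 i)//= eqxx add1n ffactnSr ffunE.
  rewrite mulnAC; congr (_ * _)%N; apply: eq_bigr => j ji.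
  by rewrite eq_sym (negPf ji).
by apply/ffunP => j; rewrite !ffunE /= addn0 -subnDA addnC.
Qed.

Lemma rsmooth_rmonomial a : rsmooth (rmonomial a).
Proof.
move=> s; rewrite rderivs_rmonomial; split=> [x i|x].
  have D := is_deriveZ (\prod_i (a i ^_ count_mem i s))%N%:R
    (is_derive_rmonomial (mdiffcount a s) x i).
  exact: (@ex_derive _ _ _ _ _ _ _ D).
exact: (continuousM (@cst_continuous _ _ _ x) (continuous_rmonomial _ x)).
Qed.

End RealSmooth.

(** * Words of directions and multi-indices *)

Section Words.
Context {d : nat}.
Implicit Types (a : multi_index d) (s : seq 'I_d).

(* [mderiv a] differentiates along this word (lemma [mderivE]); words of
   directions, unlike multi-indices, support induction on the order. *)
Definition mword a : seq 'I_d := flatten [seq nseq (a i) i | i <- enum 'I_d].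

Definition mcount s : multi_index d := [ffun i => count_mem i s].

Lemma mderivE {R : realType} a (phi : cfun R d) :
  mderiv a phi = foldr pderiv phi (mword a).
Proof.
rewrite /mderiv /mword; elim: (enum 'I_d) => [//|i r /= ->].
by rewrite foldr_cat; elim: (a i) => [//|n /= ->].
Qed.

Lemma mcount_mword a : mcount (mword a) = a.
Proof.
apply/ffunP => i; rewrite ffunE count_flatten -map_comp.
rewrite sumnE big_map big_enum (bigD1 i)//= count_nseq /= eqxx mul1n.
rewrite big1 ?addn0// => j ji; rewrite count_nseq /= (negPf ji)//.
Qed.

Lemma mabs_mcount s : mabs (mcount s) = size s.
Proof.
rewrite /mabs; under eq_bigr do rewrite ffunE.
elim: s => [|j s IH] /=; first by rewrite big1.
rewrite big_split /= IH (bigD1 j)//= eqxx big1 ?addn0// => i ij.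
by rewrite eq_sym (negPf ij).
Qed.

Lemma size_mword a : size (mword a) = mabs a.
Proof. by rewrite -mabs_mcount mcount_mword. Qed.

Lemma perm_mcount s t : mcount s = mcount t -> perm_eq s t.
Proof.
move=> E; apply/allP => i _ /=.
by have /ffunP/(_ i) := E; rewrite !ffunE => ->.
Qed.

End Words.

(** * The Euclidean norm and increments along coordinates *)

Section EuclideanNorm.
Context {R : realType} {d : nat}.
Implicit Types x y : 'rV[R]_d.

Lemma enorm_ge0 x : 0 <= enorm x.
Proof. exact: sqrtr_ge0. Qed.

Lemma enormZ (c : R) x : enorm (c *: x) = `|c| * enorm x.
Proof.
rewrite /enorm; under eq_bigr do rewrite mxE exprMn.
by rewrite -mulr_sumr sqrtrM ?sqr_ge0// sqrtr_sqr.
Qed.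

Lemma ler_enorm x y : (forall i, `|x 0 i| <= `|y 0 i|) -> enorm x <= enorm y.
Proof.
move=> xy; apply: ler_wsqrtr; apply: ler_sum => i _.
rewrite -(real_normK (num_real (x 0 i))) -(real_normK (num_real (y 0 i))).
by rewrite lerXn2r ?nnegrE.
Qed.

Lemma coord_le_enorm x i : `|x 0 i| <= enorm x.
Proof.
rewrite -sqrtr_sqr ler_wsqrtr// (bigD1 i)//= lerDl.
by apply: sumr_ge0 => j _; exact: sqr_ge0.
Qed.

Lemma rmonomial_bound (a : multi_index d) x :
  `|rmonomial a x| <= enorm x ^+ mabs a.
Proof.
rewrite /rmonomial normr_prod /mabs -prodrXr.
apply: ler_prod => i _; rewrite normr_ge0 normrX.
by rewrite lerXn2r ?nnegrE ?enorm_ge0// coord_le_enorm.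
Qed.

Lemma rmonomial0 (a : multi_index d) :
  rmonomial a (0 : 'rV[R]_d) = (a == [ffun=> 0%N])%:R.
Proof.
have [->|a0] := eqVneq.
  by rewrite /rmonomial big1// => i _; rewrite ffunE.
have [i ai] : exists i, a i != 0%N.
  apply/existsP; apply: contraNT a0; rewrite negb_exists => /forallP a0.
  by apply/eqP/ffunP => i; rewrite ffunE; apply/eqP; have := a0 i; rewrite negbK.
by rewrite /rmonomial (bigD1 i)//= mxE expr0n (negPf ai) mul0r.
Qed.

(* Moving from 0 to [y] one coordinate at a time requires only partial
   derivatives, not Frechet differentiability. *)
Lemma increment_bound (h : 'rV[R]_d -> R) y (B : R) :
  (forall x i, derivable h x (delta_mx 0 i)) ->
  (forall z i, enorm z <= enorm y -> `|rderiv i h z| <= B) ->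
  `|h y - h 0| <= d%:R * enorm y * B.
Proof.
move=> dh hB.
pose tr n : 'rV[R]_d := \row_j (if (j < n)%N then y 0 j else 0).
have tr0 : tr 0 = 0 by apply/rowP => j; rewrite !mxE.
have trd : tr d = y by apply/rowP => j; rewrite !mxE ltn_ord.
suff H n : (n <= d)%N -> `|h (tr n) - h 0| <= n%:R * enorm y * B.
  by have := H d (leqnn _); rewrite trd.
elim: n => [|n IH] nd; first by rewrite tr0 subrr normr0 !mul0r.
pose i := Ordinal nd.
have trS : tr n.+1 = tr n + y 0 i *: delta_mx 0 i.
  apply/rowP => j; rewrite !mxE eqxx /= ltnS leq_eqVlt.
  have [->|ji] := eqVneq j i; first by rewrite eqxx ltnn add0r mulr1.
  by rewrite -[(j : nat) == n]/(j == i) (negPf ji) mulr0 addr0.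
have [a /andP[a0 a1] E] := MVT_line h (tr n) (delta_mx 0 i) (y 0 i) (dh^~ i).
rewrite trS -(subrK (h (tr n)) (h _)) E -addrA.
apply: le_trans (ler_normD _ _) _.
rewrite [leLHS]addrC -natr1 !mulrDl mul1r; apply: lerD; first exact/IH/ltnW.
rewrite normrM; apply: ler_pM; rewrite ?normr_ge0 ?coord_le_enorm//.
(* Every point of the path is dominated by y coordinate by coordinate, hence stays in the ball where
   the bound B holds. *)
apply: hB; apply: ler_enorm => j; rewrite !mxE eqxx /=.
have [->|ji] := eqVneq j i.
  by rewrite ltnn add0r mulr1 normrM ger0_norm// ler_piMl.
by rewrite mulr0 addr0; case: ifP => // _; rewrite normr0.
Qed.

End EuclideanNorm.

(** * Taylor remainders *)

Section RealTaylor.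
Context {R : realType} {d : nat}.
Implicit Types (g : 'rV[R]_d -> R) (s : seq 'I_d) (x y : 'rV[R]_d).

(** Descent in the order of the derivative, with j the distance to k. A derivative that vanishes at
    0 is its own increment from 0, so each step down costs a factor d |y|; the bound at the next
    order increases with |z| and may be evaluated at y. *)
Lemma vanishing_bound (k m : nat) g (C : R) : rsmooth g -> 0 <= C ->
  (forall s, (size s < k)%N -> rderivs s g 0 = 0) ->
  (forall s y, size s = k -> `|rderivs s g y| <= C * (1 + enorm y) ^+ m) ->
  forall j s y, (size s + j)%N = k ->
    `|rderivs s g y| <= d%:R ^+ j * C * enorm y ^+ j * (1 + enorm y) ^+ m.
Proof.
move=> gs C0 g0 gk; elim=> [|j IH] s y sj.
  by rewrite !expr0 mul1r mulr1 gk// -sj addn0.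
have sk : (size s < k)%N by rewrite -sj addnS ltnS leq_addr.
rewrite -[rderivs s g y]subr0 -(g0 s sk).
apply: le_trans (@increment_bound _ _ _ y
  (d%:R ^+ j * C * enorm y ^+ j * (1 + enorm y) ^+ m) (gs s).1 _) _; last first.
  by rewrite !exprS le_eqVlt; apply/orP; left; apply/eqP; ring.
move=> z i zy; apply: le_trans (IH (i :: s) z _) _; first by rewrite /= addSnnS.
have z0 := enorm_ge0 z.
apply: ler_pM; rewrite ?mulr_ge0 ?exprn_ge0 ?ler0n ?addr_ge0//.
  by apply: ler_wpM2l; rewrite ?mulr_ge0 ?exprn_ge0 ?ler0n// lerXn2r ?nnegrE ?(le_trans z0).
by apply: lerXn2r; rewrite ?nnegrE ?lerD2l// addr_ge0 ?enorm_ge0.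
Qed.

(** The two claims are proved together because [rderivs_lin], used in the inductive step for the
    second, requires smoothness of the tail. *)
Lemma rsmooth_sum (I : Type) (r : seq I) (P : pred I) (c : I -> R)
    (G : I -> 'rV[R]_d -> R) : (forall i, rsmooth (G i)) ->
  rsmooth (fun x => \sum_(i <- r | P i) c i * G i x) /\
  forall s, rderivs s (fun x => \sum_(i <- r | P i) c i * G i x) =
    (fun x => \sum_(i <- r | P i) c i * rderivs s (G i) x).
Proof.
move=> Gs; elim: r => [|i r [IH1 IH2]].
  rewrite (_ : (fun x => _) = cst 0); last by apply/funext => x; rewrite big_nil.
  split=> [|s]; first exact: rsmooth_cst0.
  by rewrite rderivs_cst0; apply/funext => x; rewrite big_nil.
have E (F : I -> 'rV[R]_d -> R) :
    (fun x => \sum_(j <- i :: r | P j) c j * F j x) =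
    if P i then (fun x => c i * F i x + \sum_(j <- r | P j) c j * F j x)
    else (fun x => \sum_(j <- r | P j) c j * F j x).
  by apply/funext => x; rewrite big_cons; case: ifP.
split=> [|s]; rewrite !E; case: ifP => // _; first exact: rsmooth_lin.
by rewrite rderivs_lin// IH2.
Qed.

Definition rtaylor k g x : R :=
  \sum_(a : {ffun 'I_d -> 'I_k} | (mabs (mval a) < k)%N)
    rderivs (mword (mval a)) g 0 / (mfact (mval a))%:R * rmonomial (mval a) x.

Lemma rsmooth_rtaylor k g : rsmooth (rtaylor k g).
Proof.
exact: (rsmooth_sum _ _ _ _ _ (fun a => @rsmooth_rmonomial R d (mval a))).1.
Qed.

Lemma rderivs_rtaylorE k g s x : rderivs s (rtaylor k g) x =
  \sum_(a : {ffun 'I_d -> 'I_k} | (mabs (mval a) < k)%N)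
    rderivs (mword (mval a)) g 0 / (mfact (mval a))%:R *
    rderivs s (rmonomial (mval a)) x.
Proof.
rewrite /rtaylor.
by rewrite (rsmooth_sum _ _ _ _ _ (fun a => @rsmooth_rmonomial R d (mval a))).2.
Qed.

(** By counting, some letter i occurs in s more than [a i] times, and its falling factorial is
    zero. *)
Lemma rderivs_rmonomial_eq0 (a : multi_index d) s x :
  (mabs a < size s)%N -> rderivs s (rmonomial a) x = 0 :> R.
Proof.
move=> as_; rewrite rderivs_rmonomial.
have [i ai] : exists i, (a i < count_mem i s)%N.
  apply/existsP; apply: contraTT as_; rewrite negb_exists => /forallP as_.
  rewrite -leqNgt -mabs_mcount leq_sum// => i _.
  by have := as_ i; rewrite -leqNgt ffunE.
by rewrite (bigD1 i)//= ffact_small// mul0n mul0r.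
Qed.

(** When a is not the letter count of s, either some coordinate keeps a positive exponent and the
    monomial vanishes at 0, or some letter occurs too often and its falling factorial vanishes. *)
Lemma rderivs_rmonomial_0 (a : multi_index d) s :
  rderivs s (rmonomial a) 0 = (if a == mcount s then (mfact a)%:R else 0) :> R.
Proof.
rewrite rderivs_rmonomial rmonomial0.
have [->|as_] := eqVneq a.
  rewrite (_ : mdiffcount _ _ == _) ?mulr1; last first.
    by apply/eqP/ffunP => i; rewrite !ffunE subnn.
  by rewrite /mfact; congr (_%:R); apply: eq_bigr => i _; rewrite ffunE ffactnn.
have [|] := eqVneq (mdiffcount a s); last by rewrite mulr0.
move/ffunP => a0; suff -> : (\prod_i a i ^_ count_mem i s)%N = 0%N by rewrite mul0r.
have [i ai] : exists i, (a i < count_mem i s)%N.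
  apply/existsP; apply: contraNT as_; rewrite negb_exists => /forallP sa.
  apply/eqP/ffunP => i; have := a0 i; rewrite !ffunE => /eqP.
  rewrite subn_eq0 => ai; apply/eqP; rewrite eqn_leq ai.
  by have := sa i; rewrite -leqNgt.
by rewrite (bigD1 i)//= ffact_small.
Qed.

Lemma mfact_neq0 (a : multi_index d) : (mfact a)%:R != 0 :> R.
Proof.
by rewrite pnatr_eq0 -lt0n prodn_gt0// => i; exact: fact_gt0.
Qed.

Lemma rderivs_rtaylor_0 k g s : rsmooth g -> (size s < k)%N ->
  rderivs s (rtaylor k g) 0 = rderivs s g 0.
Proof.
move=> gs sk; rewrite rderivs_rtaylorE.
case: k sk => [//|k] sk.
have cs i : (mcount s i < k.+1)%N.
  by rewrite (leq_ltn_trans _ sk)// ffunE count_size.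
pose b : {ffun 'I_d -> 'I_k.+1} := [ffun i => Ordinal (cs i)].
have bE : mval b = mcount s by apply/ffunP => i; rewrite !ffunE.
rewrite (bigD1 b) /=; last by rewrite bE mabs_mcount.
rewrite rderivs_rmonomial_0 bE eqxx divfK ?mfact_neq0//.
rewrite big1 ?addr0 => [|a /andP[_ ab]]; last first.
  rewrite rderivs_rmonomial_0 ifN ?mulr0//; apply: contraNN ab => /eqP E.
  apply/eqP/ffunP => i; apply/val_inj.
  by rewrite ffunE /= -E ffunE.
(* The Taylor coefficient is a derivative along the canonical word, which is only a permutation of
   s. *)
by rewrite (@rderivs_perm _ _ _ _ s gs)//; apply: perm_mcount; rewrite mcount_mword.
Qed.

Lemma rderivs_rtaylor_high k g s x : (k <= size s)%N ->
  rderivs s (rtaylor k g) x = 0.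
Proof.
move=> ks; rewrite rderivs_rtaylorE big1// => a ak.
by rewrite rderivs_rmonomial_eq0 ?mulr0// (leq_trans ak).
Qed.

(* Written as a linear combination, so that [rderivs_lin] applies to it. *)
Definition rrem k g x : R := -1 * rtaylor k g x + g x.

Lemma rsmooth_rrem k g : rsmooth g -> rsmooth (rrem k g).
Proof. by move=> gs; apply: rsmooth_lin => //; exact: rsmooth_rtaylor. Qed.

Lemma rderivs_rrem_high k g s x : rsmooth g -> (k <= size s)%N ->
  rderivs s (rrem k g) x = rderivs s g x.
Proof.
move=> gs ks; rewrite /rrem rderivs_lin//; last exact: rsmooth_rtaylor.
by rewrite rderivs_rtaylor_high// mulr0 add0r.
Qed.

Lemma rderivs_rrem_low (k m : nat) g (C : R) : rsmooth g -> 0 <= C ->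
  (forall s y, size s = k -> `|rderivs s g y| <= C * (1 + enorm y) ^+ m) ->
  forall s y, (size s <= k)%N -> `|rderivs s (rrem k g) y| <=
    d%:R ^+ (k - size s) * C * enorm y ^+ (k - size s) * (1 + enorm y) ^+ m.
Proof.
move=> gs C0 gk s y sk; apply: (vanishing_bound k) => //; last exact: subnKC.
- exact: rsmooth_rrem.
- move=> t tk; rewrite /rrem rderivs_lin//; last exact: rsmooth_rtaylor.
  by rewrite rderivs_rtaylor_0// mulN1r addNr.
- by move=> t z tk; rewrite rderivs_rrem_high ?tk//; exact: gk.
Qed.

End RealTaylor.

(** * Complex-valued functions *)

Section ComplexParts.
Context {R : realType}.
Implicit Types (c z w : R[i]) (r : R).
Local Notation Re := complex.Re.
Local Notation Im := complex.Im.
Local Notation normc := ComplexField.Normc.normc.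

Lemma ReM c z : Re (c * z) = Re c * Re z - Im c * Im z.
Proof. by case: c z => [a b] [x y]. Qed.

Lemma ImM c z : Im (c * z) = Re c * Im z + Im c * Re z.
Proof. by case: c z => [a b] [x y]. Qed.

Lemma ReD z w : Re (z + w) = Re z + Re w.
Proof. by case: z w => [a b] [x y]. Qed.

Lemma ImD z w : Im (z + w) = Im z + Im w.
Proof. by case: z w => [a b] [x y]. Qed.

Lemma complex_ext z w : Re z = Re w -> Im z = Im w -> z = w.
Proof. by case: z w => [a b] [x y] /= -> ->. Qed.

Lemma complex_normE z : `|z| = (normc z)%:C. Proof. by case: z. Qed.

Lemma normc_ge0 z : 0 <= normc z.
Proof. by case: z => a b; exact: sqrtr_ge0. Qed.

Lemma normc_real r : normc r%:C = `|r|.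
Proof. by rewrite /= expr0n /= addr0 sqrtr_sqr. Qed.

Lemma Re_le_normc z : `|Re z| <= normc z.
Proof.
by case: z => a b; rewrite -sqrtr_sqr ler_wsqrtr// lerDl sqr_ge0.
Qed.

Lemma Im_le_normc z : `|Im z| <= normc z.
Proof.
by case: z => a b; rewrite -sqrtr_sqr ler_wsqrtr// lerDr sqr_ge0.
Qed.

Lemma normc_le_ReIm z : normc z <= `|Re z| + `|Im z|.
Proof.
case: z => a b; rewrite -[leRHS]ger0_norm ?addr_ge0// -sqrtr_sqr ler_wsqrtr//.
rewrite sqrrD -(real_normK (num_real a)) -(real_normK (num_real b)).
by rewrite lerD2r lerDl mulrn_wge0 ?mulr_ge0.
Qed.

End ComplexParts.

Section ComplexDerivatives.
Context {R : realType} {d : nat}.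
Implicit Types (phi psi : cfun R d) (s : seq 'I_d) (c : R[i]).
Local Notation Re := complex.Re.
Local Notation Im := complex.Im.
Local Notation normc := ComplexField.Normc.normc.

Definition rpart phi (x : 'rV[R]_d) : R := Re (phi x).
Definition ipart phi (x : 'rV[R]_d) : R := Im (phi x).

Definition pderivs s phi : cfun R d := foldr pderiv phi s.

Lemma cfunZE c phi x : (c *: phi) x = c * phi x.
Proof. by []. Qed.

Lemma cfunDE phi psi x : (phi + psi) x = phi x + psi x.
Proof. by []. Qed.

Lemma rpart_pderivs s phi : rpart (pderivs s phi) = rderivs s (rpart phi).
Proof. by elim: s => [//|i s /= <-]. Qed.

Lemma ipart_pderivs s phi : ipart (pderivs s phi) = rderivs s (ipart phi).
Proof. by elim: s => [//|i s /= <-]. Qed.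

Lemma smoothE phi : smooth phi <-> rsmooth (rpart phi) /\ rsmooth (ipart phi).
Proof.
split=> [sm|[rs is_] s].
  split=> s; have [dv [cr ci]] := sm s.
    by rewrite -rpart_pderivs; split=> [x i|]; [exact: (dv x i).1|exact: cr].
  by rewrite -ipart_pderivs; split=> [x i|]; [exact: (dv x i).2|exact: ci].
have [dr cr] := rs s; have [di ci] := is_ s.
rewrite -rpart_pderivs in dr cr; rewrite -ipart_pderivs in di ci.
by split; [split; [exact: dr|exact: di]|split].
Qed.

Lemma cfun_ext phi psi : rpart phi = rpart psi -> ipart phi = ipart psi ->
  phi = psi.
Proof.
move=> r i; apply/funext => x; apply: complex_ext.
  by move/funeqP : r => /(_ x).
by move/funeqP : i => /(_ x).
Qed.

Lemma rpart_lin c phi psi : rpart (c *: phi + psi) =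
  (fun x => Re c * rpart phi x + (- Im c * ipart phi x + rpart psi x)).
Proof.
by apply/funext => x; rewrite /rpart cfunDE cfunZE ReD ReM mulNr addrA.
Qed.

Lemma ipart_lin c phi psi : ipart (c *: phi + psi) =
  (fun x => Re c * ipart phi x + (Im c * rpart phi x + ipart psi x)).
Proof.
by apply/funext => x; rewrite /ipart cfunDE cfunZE ImD ImM addrA.
Qed.

Lemma smooth_lin c phi psi : smooth phi -> smooth psi -> smooth (c *: phi + psi).
Proof.
move=> /smoothE[r1 i1] /smoothE[r2 i2]; apply/smoothE.
by rewrite rpart_lin ipart_lin; split; do ?exact: rsmooth_lin;
  apply: rsmooth_lin => //; exact: rsmooth_lin.
Qed.

Lemma pderivs_lin c phi psi s : smooth phi -> smooth psi ->
  pderivs s (c *: phi + psi) = c *: pderivs s phi + pderivs s psi.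
Proof.
move=> /smoothE[r1 i1] /smoothE[r2 i2]; apply: cfun_ext.
  rewrite rpart_lin !rpart_pderivs rpart_lin ipart_pderivs rderivs_lin//.
    by rewrite rderivs_lin.
  exact: rsmooth_lin.
rewrite ipart_lin !ipart_pderivs ipart_lin rpart_pderivs rderivs_lin//.
  by rewrite rderivs_lin.
exact: rsmooth_lin.
Qed.

(** This makes scaling an instance of the results on [c *: phi + psi], without treating the zero
    function separately. *)
Lemma scaler_split c phi : c *: phi = (c - 1) *: phi + phi.
Proof. by rewrite scalerBl scale1r subrK. Qed.

Lemma smooth_Z c phi : smooth phi -> smooth (c *: phi).
Proof. by move=> sm; rewrite scaler_split; exact: smooth_lin. Qed.

Lemma pderivs_Z c phi s : smooth phi ->
  pderivs s (c *: phi) = c *: pderivs s phi.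
Proof. by move=> sm; rewrite scaler_split pderivs_lin// -scaler_split. Qed.

Lemma pderivs_perm phi s t : smooth phi -> perm_eq s t ->
  pderivs s phi = pderivs t phi.
Proof.
move=> /smoothE[r i] st; apply: cfun_ext.
  by rewrite !rpart_pderivs; exact: rderivs_perm.
by rewrite !ipart_pderivs; exact: rderivs_perm.
Qed.

Lemma smooth_dilate lambda phi : smooth phi -> smooth (dilate lambda phi).
Proof.
move=> /smoothE[r i]; apply/smoothE; split.
  exact: (rsmooth_dilate lambda^-1 (rpart phi)).
exact: (rsmooth_dilate lambda^-1 (ipart phi)).
Qed.

Lemma pderivs_dilate lambda phi s x : smooth phi ->
  pderivs s (dilate lambda phi) x =
  ((lambda^-1) ^+ size s)%:C * pderivs s phi (lambda^-1 *: x).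
Proof.
move=> /smoothE[r i]; apply: complex_ext.
  rewrite ReM mul0r subr0 -[LHS]/(rpart _ x) rpart_pderivs.
  rewrite [X in rderivs s X](_ : _ = fun x => rpart phi (lambda^-1 *: x))//.
  by rewrite rderivs_dilate// -rpart_pderivs.
rewrite ImM mul0r addr0 -[LHS]/(ipart _ x) ipart_pderivs.
rewrite [X in rderivs s X](_ : _ = fun x => ipart phi (lambda^-1 *: x))//.
by rewrite rderivs_dilate// -ipart_pderivs.
Qed.

Lemma ipart_monomial a : ipart (monomial a) = cst 0.
Proof. by []. Qed.

Lemma smooth_monomial a : smooth (monomial a : cfun R d).
Proof.
apply/smoothE; split; first exact: rsmooth_rmonomial.
by rewrite ipart_monomial; exact: rsmooth_cst0.
Qed.

Lemma pderivs_monomial a s x :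
  pderivs s (monomial a) x = (rderivs s (rmonomial a) x)%:C :> R[i].
Proof.
apply: complex_ext.
  by rewrite -[LHS]/(rpart _ x) rpart_pderivs.
by rewrite -[LHS]/(ipart _ x) ipart_pderivs ipart_monomial rderivs_cst0.
Qed.

Definition ctaylor k phi : cfun R d :=
  \sum_(a : {ffun 'I_d -> 'I_k} | (mabs (mval a) < k)%N)
    (mderiv (mval a) phi 0 / (mfact (mval a))%:R) *: monomial (mval a).

Lemma rpart_ctaylor k phi : rpart (ctaylor k phi) = rtaylor k (rpart phi).
Proof.
apply/funext => x; rewrite /rpart /ctaylor fct_sumE (big_morph (@complex.Re R) (@ReD R) erefl).
apply: eq_bigr => a _.
rewrite cfunZE ReM mulr0 subr0; congr (_ * _).
rewrite -(rmorph_nat (real_complex R)) -fmorphV ReM mulr0 subr0.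
by rewrite mderivE -rpart_pderivs.
Qed.

Lemma ipart_ctaylor k phi : ipart (ctaylor k phi) = rtaylor k (ipart phi).
Proof.
apply/funext => x; rewrite /ipart /ctaylor fct_sumE (big_morph (@complex.Im R) (@ImD R) erefl).
apply: eq_bigr => a _.
rewrite cfunZE ImM mulr0 add0r; congr (_ * _).
rewrite -(rmorph_nat (real_complex R)) -fmorphV ImM mulr0 add0r.
by rewrite mderivE -ipart_pderivs.
Qed.

Definition crem k phi : cfun R d := (-1) *: ctaylor k phi + phi.

Lemma rpart_crem k phi : rpart (crem k phi) = rrem k (rpart phi).
Proof.
rewrite rpart_lin rpart_ctaylor; apply/funext => x.
by rewrite /rrem /= oppr0 oppr0 mul0r add0r.
Qed.

Lemma ipart_crem k phi : ipart (crem k phi) = rrem k (ipart phi).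
Proof.
rewrite ipart_lin ipart_ctaylor; apply/funext => x.
by rewrite /rrem /= oppr0 mul0r add0r.
Qed.

Lemma smooth_crem k phi : smooth phi -> smooth (crem k phi).
Proof.
move=> /smoothE[r i]; apply/smoothE; rewrite rpart_crem ipart_crem.
by split; exact: rsmooth_rrem.
Qed.

Lemma pderivs_crem_high k phi s x : smooth phi -> (k <= size s)%N ->
  pderivs s (crem k phi) x = pderivs s phi x.
Proof.
move=> /smoothE[r i] ks; apply: complex_ext.
  rewrite -[LHS]/(rpart _ x) rpart_pderivs rpart_crem rderivs_rrem_high//.
  by rewrite -rpart_pderivs.
rewrite -[LHS]/(ipart _ x) ipart_pderivs ipart_crem rderivs_rrem_high//.
by rewrite -ipart_pderivs.
Qed.

(** The factor 2 comes from adding the real estimate for the real and for the imaginary part, each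
    with the same C. *)
Lemma pderivs_crem_low k m phi (C : R) : smooth phi -> 0 <= C ->
  (forall s y, size s = k -> normc (pderivs s phi y) <= C * (1 + enorm y) ^+ m) ->
  forall s y, (size s <= k)%N -> normc (pderivs s (crem k phi) y) <=
    2 * d%:R ^+ (k - size s) * C * enorm y ^+ (k - size s) * (1 + enorm y) ^+ m.
Proof.
move=> /smoothE[r i] C0 H s y sk; apply: le_trans (normc_le_ReIm _) _.
rewrite -!mulrA mulr2n mulrDl mul1r !mulrA; apply: lerD.
  rewrite -[Re _]/(rpart _ y) rpart_pderivs rpart_crem.
  apply: rderivs_rrem_low => // t z tk; rewrite -rpart_pderivs.
  exact: le_trans (Re_le_normc _) (H _ _ tk).
rewrite -[Im _]/(ipart _ y) ipart_pderivs ipart_crem.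
apply: rderivs_rrem_low => // t z tk; rewrite -ipart_pderivs.
exact: le_trans (Im_le_normc _) (H _ _ tk).
Qed.

End ComplexDerivatives.

(** * The norms of dilated remainders *)

Section Weights.
Context {R : realType}.
Implicit Types (r t : R) (n q k : nat).

Lemma weight_nat r n q : (n <= q)%N ->
  r ^ (q%:Z - n%:Z) = r ^+ (q - n).
Proof. by move=> nq; rewrite subzn. Qed.

Lemma weight_neg r n q : (q <= n)%N ->
  r ^ (q%:Z - n%:Z) = r^-1 ^+ (n - q).
Proof. by move=> qn; rewrite -opprB subzn// -exprnN exprVn. Qed.

(** For n <= q the exponent is nonnegative, and the prefactor lambda^(k-n) and the dilation can only
    decrease the value. For n > q, the part lambda^(q-n) of the prefactor turns 1 + r/lambda into
    lambda + r >= 1 + r, and the rest, lambda^(k-q), is at most 1. *)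
Lemma weight_dilate (lambda r : R) n k q : 1 <= lambda -> 0 <= r ->
  (k <= q)%N -> (k <= n)%N ->
  lambda ^+ k * lambda^-1 ^+ n * (1 + lambda^-1 * r) ^ (q%:Z - n%:Z) <=
  (1 + r) ^ (q%:Z - n%:Z).
Proof.
move=> l1 r0 kq kn; have l0 : 0 < lambda by exact: lt_le_trans l1.
have li0 : 0 <= lambda^-1 by rewrite invr_ge0 ltW.
have li1 : lambda^-1 <= 1 by rewrite invf_le1.
have powE m : (k <= m)%N -> lambda ^+ k * lambda^-1 ^+ m = lambda^-1 ^+ (m - k).
  move=> km; rewrite -{1}(subnKC km) exprD mulrA -exprMn mulfV ?gt_eqF//.
  by rewrite expr1n mul1r.
have pow1 m : lambda^-1 ^+ m <= 1 by rewrite exprn_ile1.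
have [nq|qn] := leqP n q.
  rewrite !weight_nat// powE// -[leRHS]mul1r.
  apply: ler_pM; rewrite ?exprn_ge0 ?addr_ge0 ?mulr_ge0//.
  apply: lerXn2r; rewrite ?nnegrE ?addr_ge0 ?mulr_ge0// lerD2l.
  by rewrite ler_piMl.
have {}qn := ltnW qn.
rewrite !weight_neg// -{1}(subnKC qn) exprD mulrA powE// -mulrA -exprMn.
rewrite -[leRHS]mul1r -invfM mulrDr mulr1 mulVKf ?gt_eqF//.
apply: ler_pM; rewrite ?exprn_ge0 ?invr_ge0 ?addr_ge0 ?(ltW l0)//.
apply: lerXn2r; rewrite ?nnegrE ?invr_ge0 ?addr_ge0 ?(ltW l0)//.
by rewrite lef_pV2 ?posrE ?lerD2r// ltr_wpDr.
Qed.

(** The powers of lambda cancel exactly, the factor r/lambda to the power k - n supplying what is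
    missing; then r and 1 + r/lambda are both at most 1 + r. *)
Lemma weight_dilate_low (lambda r : R) n k q : 1 <= lambda -> 0 <= r ->
  (k <= q)%N -> (n <= k)%N ->
  lambda ^+ k * lambda^-1 ^+ n *
    ((lambda^-1 * r) ^+ (k - n) * (1 + lambda^-1 * r) ^+ (q - k)) <=
  (1 + r) ^ (q%:Z - n%:Z).
Proof.
move=> l1 r0 kq nk; have l0 : 0 < lambda by exact: lt_le_trans l1.
have li0 : 0 <= lambda^-1 by rewrite invr_ge0 ltW.
have li1 : lambda^-1 <= 1 by rewrite invf_le1.
rewrite weight_nat ?(leq_trans nk)// exprMn.
rewrite -mulrA [_ ^+ n * _]mulrA [_ ^+ n * _]mulrA -exprD subnKC// !mulrA -exprMn.
rewrite mulfV ?gt_eqF// expr1n mul1r.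
have -> : (q - n = (k - n) + (q - k))%N by rewrite addnC addnBA// subnK.
rewrite exprD; apply: ler_pM; rewrite ?exprn_ge0 ?addr_ge0 ?mulr_ge0//.
  by apply: lerXn2r; rewrite ?nnegrE ?addr_ge0// lerDr.
apply: lerXn2r; rewrite ?nnegrE ?addr_ge0 ?mulr_ge0// lerD2l.
by rewrite ler_piMl.
Qed.

End Weights.

Section KBounds.
Context {R : realType} {d : nat} (M : nat -> R).
Hypothesis hM : forall p, 0 < M p.
Implicit Types (phi psi : cfun R d) (l B C : R) (q k : nat) (s : seq 'I_d).
Local Notation normc := ComplexField.Normc.normc.

(** This is the norm bound [Knorm M l q phi <= B] with denominators cleared and stated over words,
    the form in which the Taylor estimates take it ([KnormP]). *)
Definition Kbound l q B phi := smooth phi /\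
  forall s x, normc (pderivs s phi x) <=
    B * (l ^+ size s * M (size s)) * (1 + enorm x) ^ (q%:Z - (size s)%:Z).

Lemma weight_gt0 (x : 'rV[R]_d) (z : int) : 0 < (1 + enorm x) ^ z.
Proof. by rewrite exprz_gt0// ltr_pwDl// enorm_ge0. Qed.

Lemma Kbound_ge0 l q B phi : Kbound l q B phi -> 0 <= B.
Proof.
move=> [_ /(_ [::] 0)] /=; rewrite mul1r => H.
have := le_trans (normc_ge0 _) H.
by rewrite pmulr_lge0 ?weight_gt0// pmulr_lge0.
Qed.

(** The norm only tests canonical words; an arbitrary word is a permutation of one of them, so
    symmetry of mixed partial derivatives gives the forward direction. *)
Lemma KnormP l q B phi : 0 < l -> smooth phi ->
  (Knorm M l q phi <= B%:E)%E <-> Kbound l q B phi.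
Proof.
move=> l0 sm; split=> [H|[_ H]].
  split=> // s x.
  have E : pderivs s phi = mderiv (mcount s) phi.
    rewrite mderivE; apply: pderivs_perm => //.
    by apply: perm_mcount; rewrite mcount_mword.
  have : (((1 + enorm x) ^ ((mabs (mcount s))%:Z - q%:Z) *
           normc (mderiv (mcount s) phi x) /
         (l ^+ mabs (mcount s) * M (mabs (mcount s))))%:E <= Knorm M l q phi)%E.
    by apply: ereal_sup_ubound; exists (mcount s), x.
  move=> /le_trans/(_ H); rewrite lee_fin mabs_mcount -E.
  rewrite ler_pdivrMr ?mulr_gt0 ?exprn_gt0// => {}H.
  rewrite -opprB -invr_expz ler_pdivlMr ?weight_gt0//.
  by rewrite mulrC.
apply: ub_ereal_sup => _ [a [x ->]]; rewrite lee_fin.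
rewrite ler_pdivrMr ?mulr_gt0 ?exprn_gt0//.
have := H (mword a) x; rewrite size_mword /pderivs -mderivE => {}H.
by rewrite mulrC -ler_pdivlMr ?weight_gt0// invr_expz opprB.
Qed.

Lemma Kbound_lin l q B B' c phi psi : Kbound l q B phi -> Kbound l q B' psi ->
  Kbound l q (normc c * B + B') (c *: phi + psi).
Proof.
move=> [s1 b1] [s2 b2]; split=> [|s x]; first exact: smooth_lin.
rewrite pderivs_lin// cfunDE cfunZE.
apply: le_trans (le_normcD _ _) _.
rewrite ComplexField.Normc.normcM !mulrDl -!mulrA; apply: lerD.
  by apply: ler_wpM2l; [exact: normc_ge0|have := b1 s x; rewrite -!mulrA].
by have := b2 s x; rewrite -!mulrA.
Qed.

Lemma Kbound_Z l q B (r : R) phi : Kbound l q B phi ->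
  Kbound l q (`|r| * B) (r%:C *: phi).
Proof.
move=> [sm H]; split=> [|s x]; first exact: smooth_Z.
rewrite pderivs_Z// cfunZE ComplexField.Normc.normcM.
by rewrite normc_real -!mulrA ler_wpM2l//; have := H s x; rewrite -!mulrA.
Qed.

Lemma Kbound_mono l l' q q' B phi : 0 < l <= l' -> (q <= q')%N ->
  Kbound l q B phi -> Kbound l' q' B phi.
Proof.
move=> /andP[l0 ll'] qq' b; have B0 := Kbound_ge0 _ _ _ _ b.
case: b => sm H; split=> // s x; apply: le_trans (H s x) _.
apply: ler_pM; rewrite ?mulr_ge0 ?exprn_ge0 ?(ltW l0) ?(ltW (hM _)) ?(ltW (weight_gt0 _ _))//.
  apply: ler_wpM2l => //; apply: ler_wpM2r; first exact: ltW.
  by apply: lerXn2r; rewrite ?nnegrE ?(ltW l0) ?(le_trans (ltW l0)).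
by apply: ler_weXz2l; [rewrite lerDl enorm_ge0|rewrite lerD2r].
Qed.

Lemma Kbound_monomial l q (a : multi_index d) : 0 < l -> (mabs a <= q)%N ->
  exists B, Kbound l q B (monomial a).
Proof.
move=> l0 aq.
pose n0 (s : seq 'I_d) := (\prod_i (a i ^_ count_mem i s))%N.
pose N := (mfact a)%:R : R.
(* The products of falling factorials are at most a! when nonzero, and the sum dominates each 1 /
   (l^n M_n) with n <= |a|, replacing a maximum; higher derivatives vanish. *)
exists (N * \sum_(n < (mabs a).+1) (l ^+ n * M n)^-1).
split=> [|s x]; first exact: smooth_monomial.
have w0 n : 0 < l ^+ n * M n by rewrite mulr_gt0 ?exprn_gt0.
have S0 : 0 <= \sum_(n < (mabs a).+1) (l ^+ n * M n)^-1.
  by apply: sumr_ge0 => n _; rewrite invr_ge0 ltW.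
rewrite pderivs_monomial normc_real.
have [as_|sa] := ltnP (mabs a) (size s).
  rewrite rderivs_rmonomial_eq0// normr0.
  by rewrite !mulr_ge0 ?ler0n ?exprn_ge0 ?(ltW (hM _)) ?(ltW l0) ?(ltW (weight_gt0 _ _)).
rewrite rderivs_rmonomial -/(n0 s).
have [n00|n0N] := eqVneq (n0 s) 0%N.
  rewrite n00 mul0r normr0.
  by rewrite !mulr_ge0 ?ler0n ?exprn_ge0 ?(ltW (hM _)) ?(ltW l0) ?(ltW (weight_gt0 _ _)).
have cs i : (count_mem i s <= a i)%N.
  rewrite leqNgt; apply: contraNN n0N => ai.
  by rewrite /n0 (bigD1 i)//= ffact_small.
have n0le : (n0 s <= mfact a)%N.
  by apply: leq_prod => i _; rewrite -(ffact_fact (cs i)) leq_pmulr ?fact_gt0.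
have ms : mabs (mdiffcount a s) = (mabs a - size s)%N.
  apply/eqP; rewrite -(eqn_add2r (size s)) subnK//; apply/eqP.
  rewrite -[size s]mabs_mcount -big_split /=; apply: eq_bigr => j _.
  by rewrite !ffunE subnK.
rewrite weight_nat ?(leq_trans sa)// normrM normr_nat.
apply: ler_pM; rewrite ?ler0n//.
  rewrite -[leLHS]mulr1 -mulrA; apply: ler_pM; rewrite ?ler0n ?ler_nat//.
  rewrite (bigD1 (Ordinal (sa : (size s < (mabs a).+1)%N)))//= mulrDl.
  rewrite mulVf ?gt_eqF// lerDl mulr_ge0 ?(ltW (w0 _))//.
  by apply: sumr_ge0 => n _; rewrite invr_ge0 ltW.
apply: le_trans (rmonomial_bound _ _) _; rewrite ms.
have e0 := enorm_ge0 x.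
apply: (@le_trans _ _ ((1 + enorm x) ^+ (mabs a - size s))).
  by apply: lerXn2r; rewrite ?nnegrE ?addr_ge0// lerDr.
apply: ler_weXn2l; first by rewrite lerDl.
exact: leq_sub2r.
Qed.

Lemma remainder_bound l q B k phi : 0 < l -> (k <= q)%N -> Kbound l q B phi ->
  exists C, forall lambda, 1 <= lambda ->
    Kbound l q C ((lambda ^+ k)%:C *: dilate lambda (crem k phi)).
Proof.
move=> l0 kq b; have B0 := Kbound_ge0 _ _ _ _ b; case: b => sm H.
have w0 n : 0 < l ^+ n * M n by rewrite mulr_gt0 ?exprn_gt0.
(* [C0] is the constant of the bound on derivatives of order exactly k, and [K n] the resulting
   Taylor constant at order n. In the final constant B covers the orders at least k, and T the
   orders below k, again with a sum in place of a maximum. *)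
pose C0 := B * (l ^+ k * M k).
have C00 : 0 <= C0 by rewrite mulr_ge0// ltW.
pose K n := 2 * d%:R ^+ (k - n) * C0.
have K0 n : 0 <= K n by rewrite /K mulr_ge0// mulr_ge0 ?exprn_ge0 ?ler0n.
pose T := \sum_(n < k) K n / (l ^+ n * M n).
have T0 : 0 <= T by apply: sumr_ge0 => n _; rewrite divr_ge0// ltW.
exists (B + T) => lambda l1.
have lam0 : 0 < lambda by exact: lt_le_trans l1.
have li0 : 0 <= lambda^-1 by rewrite invr_ge0 ltW.
have sr := smooth_crem k phi sm.
have sd := smooth_dilate lambda _ sr.
split=> [|s x]; first exact: smooth_Z.
rewrite pderivs_Z// cfunZE pderivs_dilate// [X in normc X]mulrA -rmorphM.
rewrite ComplexField.Normc.normcM normc_real.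
rewrite ger0_norm ?mulr_ge0 ?exprn_ge0 ?(ltW lam0)//.
have nE : enorm (lambda^-1 *: x) = lambda^-1 * enorm x.
  by rewrite enormZ ger0_norm.
have e0 := enorm_ge0 x.
have [ks|sk] := leqP k (size s).
  rewrite pderivs_crem_high//.
  apply: (@le_trans _ _ (B * (l ^+ size s * M (size s)) *
    (1 + enorm x) ^ (q%:Z - (size s)%:Z))); last first.
    apply: ler_wpM2r; first exact/ltW/weight_gt0.
    by apply: ler_wpM2r; [exact: ltW|rewrite lerDl].
  apply: (@le_trans _ _ (B * (l ^+ size s * M (size s)) *
    (lambda ^+ k * lambda^-1 ^+ size s *
      (1 + lambda^-1 * enorm x) ^ (q%:Z - (size s)%:Z)))).
    rewrite mulrCA; apply: ler_wpM2l; last by rewrite -nE; exact: H.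
    by rewrite mulr_ge0 ?exprn_ge0 ?(ltW lam0).
  apply: ler_wpM2l; first by rewrite mulr_ge0// ltW.
  exact: weight_dilate.
have low : normc (pderivs s (crem k phi) (lambda^-1 *: x)) <= K (size s) *
    ((lambda^-1 * enorm x) ^+ (k - size s) * (1 + lambda^-1 * enorm x) ^+ (q - k)).
  rewrite mulrA -nE; apply: pderivs_crem_low => //; last exact: ltnW.
  by move=> t y tk; rewrite -weight_nat// -tk; have := H t y; rewrite /C0 tk.
apply: (@le_trans _ _ (K (size s) * (1 + enorm x) ^ (q%:Z - (size s)%:Z))).
  apply: le_trans (ler_wpM2l _ low) _.
    by rewrite mulr_ge0 ?exprn_ge0 ?(ltW lam0).
  rewrite mulrCA; apply: ler_wpM2l => //.
  by apply: weight_dilate_low => //; exact: ltnW.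
apply: ler_wpM2r; first exact/ltW/weight_gt0.
rewrite -ler_pdivrMr// /T (bigD1 (Ordinal sk))//= addrCA lerDl addr_ge0//.
by apply: sumr_ge0 => n _; rewrite divr_ge0// ltW.
Qed.

End KBounds.

(** * Bounded sets and continuous functionals *)

Section KDual.
Context {R : realType} {d : nat} (M : nat -> R).
Hypothesis hM : forall p, 0 < M p.
Implicit Types (phi psi : cfun R d) (S V : set (cfun R d)) (c : uclass) (q : nat).
Local Notation normc := ComplexField.Normc.normc.

(* [S] is bounded in K_q^*, for the Roumieu case in a single step K_q^{M,l} of
   the inductive limit. *)
Definition Kbdd c q S := match c with
  | Beurling => forall l : R, 0 < l ->
      exists B, forall phi, S phi -> Kbound M l q B phi
  | Roumieu => exists2 l : R, 0 < l &
      exists B, forall phi, S phi -> Kbound M l q B phi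
  end.

Lemma carrier_Kql (l : {posnum R}) q phi :
  carrier (Kql d M q l%:num) phi <-> exists B, Kbound M l%:num q B phi.
Proof.
have l0 : 0 < l%:num by [].
split=> [[sm]|[B b]].
  case E : (Knorm M l%:num q phi) => [r| |]// _.
    by exists r; apply/KnormP => //; rewrite E.
  (* This is the formal case of a supremum equal to -oo, for which any real bound serves. *)
  by exists 0; apply/KnormP => //; rewrite E leNye.
split; first exact: b.1.
by apply: le_lt_trans (ltry B); apply/KnormP => //; exact: b.1.
Qed.

Lemma carrier_Kq c q phi : carrier (Kq d M c q) phi <-> Kbdd c q [set phi].
Proof.
case: c => /=; split.
- by move=> H l l0; have /carrier_Kql[B b] := H (PosNum l0) I; exists B => _ ->.
- by move=> H l _; apply/carrier_Kql; have [|B b] := H l%:num => //; exists B; exact: b.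
- by move=> [l _ /carrier_Kql[B b]]; exists l%:num => //; exists B => _ ->.
- by move=> [l l0 [B b]]; exists (PosNum l0) => //; apply/carrier_Kql; exists B; exact: b.
Qed.

Lemma carrierP c phi :
  carrier (Kspace d M c) phi <-> exists q, Kbdd c q [set phi].
Proof.
split=> [[q _ /carrier_Kq b]|[q b]]; first by exists q.
by exists q => //; apply/carrier_Kq.
Qed.

Lemma Kbdd_sub c q S S' : S' `<=` S -> Kbdd c q S -> Kbdd c q S'.
Proof.
move=> SS; case: c => /= [H l /H[B b]|[l l0 [B b]]].
  by exists B => phi /SS; exact: b.
by exists l => //; exists B => phi /SS; exact: b.
Qed.

Lemma Kbdd_mono c q q' S : (q <= q')%N -> Kbdd c q S -> Kbdd c q' S.
Proof.
move=> qq'; case: c => /= [H l l0|[l l0 [B b]]].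
  have [B b] := H l l0; exists B => phi /b.
  by apply: Kbound_mono => //; rewrite l0 lexx.
exists l => //; exists B => phi /b.
by apply: Kbound_mono => //; rewrite l0 lexx.
Qed.

Lemma Kbdd_Z c q S (r : R) : Kbdd c q S -> Kbdd c q [set r%:C *: phi | phi in S].
Proof.
case: c => /= [H l l0|[l l0 [B b]]].
  have [B b] := H l l0; exists (`|r| * B) => _ [phi /b ? <-].
  exact: Kbound_Z.
by exists l => //; exists (`|r| * B) => _ [phi /b ? <-]; exact: Kbound_Z.
Qed.

Lemma carrier_lin c (a : R[i]) phi psi : carrier (Kspace d M c) phi ->
  carrier (Kspace d M c) psi -> carrier (Kspace d M c) (a *: phi + psi).
Proof.
move=> /carrierP[q1 b1] /carrierP[q2 b2]; apply/carrierP.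
exists (maxn q1 q2).
have {}b1 := Kbdd_mono c _ _ _ (leq_maxl q1 q2) b1.
have {}b2 := Kbdd_mono c _ _ _ (leq_maxr q1 q2) b2.
case: c b1 b2 => /= [H1 H2 l l0|[l1 l10 [B1 b1]] [l2 l20 [B2 b2]]].
  have [B1 b1] := H1 l l0; have [B2 b2] := H2 l l0.
  by exists (normc a * B1 + B2) => _ ->; apply: Kbound_lin; [exact: b1|exact: b2].
exists (Num.max l1 l2); first by rewrite lt_max l10.
exists (normc a * B1 + B2) => _ ->.
apply: Kbound_lin.
  by apply: Kbound_mono (b1 _ erefl) => //; rewrite l10 le_max lexx.
by apply: Kbound_mono (b2 _ erefl) => //; rewrite l20 le_max lexx orbT.
Qed.

Lemma carrier_monomial c a : carrier (Kspace d M c) (monomial a).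
Proof.
apply/carrierP; exists (mabs a); case: c => /= [l l0|].
  by have [B b] := Kbound_monomial M hM l (mabs a) a l0 (leqnn _); exists B => _ ->.
exists 1 => //.
by have [B b] := Kbound_monomial M hM 1 (mabs a) a ltr01 (leqnn _); exists B => _ ->.
Qed.

Lemma carrier0 c : carrier (Kspace d M c) 0.
Proof.
have m := carrier_monomial c [ffun=> 0%N].
by rewrite -(addNr (monomial [ffun=> 0%N])) -scaleN1r; exact: carrier_lin.
Qed.

(** Absorption holds for all small r, not just for one, so that finitely many neighbourhoods can
    share a factor. *)
Lemma Kql_absorb (l : {posnum R}) q S V (B : R) :
  (forall phi, S phi -> Kbound M l%:num q B phi) ->
  nbhs0 (Kql d M q l%:num) V ->
  exists2 e : R, 0 < e &
    forall r : R, 0 < r <= e -> forall phi, S phi -> V (r%:C *: phi).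
Proof.
(* If S is empty, B may be negative, so the positive quantity [|B| + 1] replaces it; halving e below
   makes the final inequality strict. *)
move=> SB [e e0 eV]; have B1 : 0 < `|B| + 1 by rewrite ltr_wpDl.
exists (e / 2 / (`|B| + 1)); first by rewrite !divr_gt0.
move=> r /andP[r0 re] phi Sphi; apply: eV.
have b := Kbound_Z M l%:num q B r phi (SB _ Sphi).
split; first exact: b.1.
have : (Knorm M l%:num q (r%:C *: phi) <= (`|r| * B)%:E)%E.
  by apply/KnormP => //; exact: b.1.
move=> /le_lt_trans; apply; rewrite lte_fin gtr0_norm//.
apply: (@le_lt_trans _ _ (r * (`|B| + 1))).
  by rewrite ler_pM2l// (le_trans (ler_norm B))// lerDl.
rewrite ler_pdivlMr// in re; apply: le_lt_trans re _.
by rewrite ltr_pdivrMr// ltr_pMr// ltr1n.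
Qed.

(** A neighbourhood in an inductive limit contains a set that is a neighbourhood in every step, so
    it suffices to absorb S in the step where it is bounded. *)
Lemma Kspace_absorb c q S V : Kbdd c q S -> nbhs0 (Kspace d M c) V ->
  exists2 e : R, 0 < e & forall phi, S phi -> V (e%:C *: phi).
Proof.
move=> bS [V1 [_ _ /(_ q) V1q V1V]].
suff [e e0 H] : exists2 e : R, 0 < e & forall phi, S phi -> V1 (e%:C *: phi).
  by exists e => // phi /H /V1V.
case: c bS V1q => /= [bS [s [W [sW WV]]]|[l l0 [B b]] [V2 [_ _ V2l V21]]].
  (* In the Beurling case a neighbourhood involves finitely many values of l; induction on their
     list takes the minimum of the factors. *)
  have [e e0 He] : exists2 e : R, 0 < e & forall i, i \in s ->
      forall r : R, 0 < r <= e -> forall phi, S phi -> W i (r%:C *: phi).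
    elim: s sW {WV} => [_|i s IH sW]; first by exists 1.
    have [|e1 e10 H1] := IH.
      by move=> j js; apply: sW; rewrite inE js orbT.
    have [|B b] := bS i%:num; first by [].
    have [e2 e20 H2] := Kql_absorb i q S (W i) B b (sW i (mem_head _ _)).
    exists (Num.min e1 e2); first by rewrite lt_min e10.
    move=> j; rewrite inE => /orP[/eqP->|js] r; rewrite le_min => /and3P[r0 r1 r2].
      by apply: H2; rewrite r0.
    by apply: H1 => //; rewrite r0.
  exists e => // phi Sphi; apply: WV; split=> [i _|i /= si]; last first.
    by apply: He => //; rewrite e0 lexx.
  have [|B b] := bS i%:num; first by [].
  by apply/carrier_Kql; exists (`|e| * B); apply: Kbound_Z; exact: b.
have [e e0 He] := Kql_absorb (PosNum l0) q S V2 B b (V2l _).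
by exists e => // phi Sphi; apply: V21; apply: He => //; rewrite e0 lexx.
Qed.

Section Functional.
Variables (c : uclass) (f : cfun R d -> R[i]).
Hypothesis hf : in_dual (Kspace d M c) f.
Local Notation K := (carrier (Kspace d M c)).

Lemma dual0 : f 0 = 0.
Proof.
have /eqP := hf.1 1 0 0 (carrier0 c) (carrier0 c).
by rewrite scale1r addr0 mul1r -subr_eq subrr eq_sym => /eqP.
Qed.

Lemma dualZ (a : R[i]) phi : K phi -> f (a *: phi) = a * f phi.
Proof.
by move=> p; have := hf.1 a phi 0 p (carrier0 c); rewrite !addr0 dual0 addr0.
Qed.

(** Linearity of f is available only on the carrier, so membership is carried through the induction.
    The final term psi is the place of the Taylor remainder. *)
Lemma dual_sum (I : Type) (r : seq I) (P : pred I) (b : I -> R[i])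
    (G : I -> cfun R d) psi : (forall i, K (G i)) -> K psi ->
  K (\sum_(i <- r | P i) b i *: G i + psi) /\
  f (\sum_(i <- r | P i) b i *: G i + psi) =
    \sum_(i <- r | P i) b i * f (G i) + f psi.
Proof.
move=> KG Kpsi; elim: r => [|i r [IH1 IH2]]; first by rewrite !big_nil !add0r.
rewrite !big_cons; case: ifP => // _; rewrite -!addrA -IH2.
by split; [exact: carrier_lin|exact: hf.1].
Qed.

(** Continuity at 0 gives a neighbourhood on which |f| < 1; if e S lies in it, homogeneity bounds f
    by 1/e on S. *)
Lemma dual_bounded q S : Kbdd c q S ->
  exists C : R, forall phi, S phi -> normc (f phi) <= C.
Proof.
move=> bS.
(* The premise [K psi] reflects that continuity is relative to the carrier, outside which f is
   arbitrary. *)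
have nb : nbhs0 (Kspace d M c) [set psi | K psi -> `|f psi| < 1].
  rewrite (_ : mkset _ =
      [set psi | K psi -> ball (f 0 : R[i]^o) 1 (f (0 + psi) : R[i]^o)]).
    exact: (hf.2 0 (carrier0 c) _ (nbhsx_ballx (f 0 : R[i]^o) 1 ltr01)).
  apply/funext => psi; rewrite /mkset.
  by rewrite -ball_normE /ball_ /= add0r dual0 sub0r normrN.
have [e e0 He] := Kspace_absorb c q S _ bS nb.
exists e^-1 => phi Sphi.
have Kp : K phi.
  by apply/carrierP; exists q; apply: Kbdd_sub bS => _ ->.
have Ke : K (e%:C *: phi).
  by rewrite -[_ *: _]addr0; apply: carrier_lin => //; exact: carrier0.
have := He _ Sphi Ke; rewrite dualZ// complex_normE ltcR ComplexField.Normc.normcM.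
by rewrite normc_real gtr0_norm// mulrC -ltr_pdivlMr// div1r => /ltW.
Qed.

End Functional.
End KDual.

(** * The moment asymptotic expansion *)

Section Expansion.
Context {R : realType} {d : nat} (M : nat -> R).
Hypothesis hM : forall p, 0 < M p.
Variables (c : uclass) (f : cfun R d -> R[i]).
Hypothesis hf : in_dual (Kspace d M c) f.
Local Notation K := (carrier (Kspace d M c)).
Local Notation normc := ComplexField.Normc.normc.
Implicit Types (phi : cfun R d) (a : multi_index d).

Lemma dilate_monomial (lambda : R) a :
  dilate lambda (monomial a) = ((lambda^-1) ^+ mabs a)%:C *: monomial a.
Proof.
apply/funext => x; rewrite cfunZE /dilate /monomial -rmorphM.
congr (_%:C); rewrite /mabs -prodrXr -big_split /=; apply: eq_bigr => i _.
by rewrite mxE exprMn.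
Qed.

(** Dilation only rescales a monomial, so lambda is moved into the coefficients and [dual_sum]
    applies to fixed monomials. *)
Lemma dilate_taylor (lambda : R) k phi : dilate lambda phi =
  \sum_(a : {ffun 'I_d -> 'I_k} | (mabs (mval a) < k)%N)
    (mderiv (mval a) phi 0 / (mfact (mval a))%:R *
      ((lambda^-1) ^+ mabs (mval a))%:C) *: monomial (mval a)
  + dilate lambda (crem k phi).
Proof.
apply/funext => x; rewrite cfunDE fct_sumE.
rewrite [in RHS]/dilate /crem cfunDE scaleN1r.
rewrite [(- _) _]/(- _) /ctaylor fct_sumE addrA -[LHS]add0r; congr (_ + _).
apply/esym; rewrite -sumrB big1// => a _; rewrite !cfunZE.
by rewrite -[monomial _ (_ *: x)]/(dilate _ _ _) dilate_monomial cfunZE mulrA subrr.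
Qed.

Lemma Kbdd_remainder q k phi : (k <= q)%N -> Kbdd M c q [set phi] ->
  Kbdd M c q [set (lambda ^+ k)%:C *: dilate lambda (crem k phi) |
              lambda in [set lambda | 1 <= lambda]].
Proof.
move=> kq; case: c => /= [H l l0|[l l0 [B b]]].
  have [B b] := H l l0.
  have [C HC] := remainder_bound M hM l q B k phi l0 kq (b _ erefl).
  by exists C => _ [lambda l1 <-]; exact: HC.
exists l => //; have [C HC] := remainder_bound M hM l q B k phi l0 kq (b _ erefl).
by exists C => _ [lambda l1 <-]; exact: HC.
Qed.

Lemma dual_has_moments :
  has_moments (Kspace d M c) f (fun a => f (monomial a)).
Proof.
move=> phi k /(carrierP M hM)[q bq].
have {bq} := Kbdd_mono M hM c _ _ _ (leq_maxl q k) bq.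
move/(Kbdd_remainder _ _ _ (leq_maxr q k)) => bS.
have [C HC] := dual_bounded M hM c f hf _ _ bS.
exists C; near=> lambda.
have l1 : 1 <= lambda by near: lambda; exact: nbhs_pinfty_ge.
have l0 : 0 < lambda by exact: lt_le_trans l1.
set psi := dilate lambda (crem k phi).
(* Membership comes from the bounded family itself: psi is lambda^-k times one of its members. *)
have Kpsi : K psi.
  apply/(carrierP M hM); exists (maxn q k).
  apply: Kbdd_sub (Kbdd_Z M c _ _ (lambda ^- k) bS) => _ -> /=.
  exists ((lambda ^+ k)%:C *: psi); first by exists lambda.
  by rewrite scalerA -rmorphM mulVf ?rmorph1 ?scale1r// expf_neq0 ?gt_eqF.
have := HC _ (ex_intro2 _ _ lambda l1 erefl).
rewrite -/psi (dualZ M hM c f hf)// ComplexField.Normc.normcM normc_real.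
rewrite ger0_norm ?exprn_ge0 ?(ltW l0)// => Hpsi.
(* By homogeneity the Taylor polynomial cancels against the expansion term by term, leaving the
   remainder alone. *)
have -> : dilate_dual f lambda phi -
         \sum_(a : {ffun 'I_d -> 'I_k} | (mabs (mval a) < k)%N)
           f (monomial (mval a)) * mderiv (mval a) phi 0 /
             ((mfact (mval a))%:R * (lambda ^+ (mabs (mval a) + d))%:C)
    = (lambda ^- d)%:C * f psi.
  rewrite /dilate_dual (dilate_taylor lambda k phi).
  rewrite (dual_sum M hM c f hf _ _ _ _ _ _ (fun a : {ffun 'I_d -> 'I_k} => carrier_monomial M hM c (mval a)) Kpsi).2.
  rewrite mulrDr addrAC -[RHS]add0r; congr (_ + _).
  rewrite mulr_sumr -sumrB big1// => a _.
  rewrite exprD invfM -[(_ ^+ _ * _)%:C^-1]fmorphV /= invfM rmorphM /= exprVn.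
  apply/eqP; rewrite subr_eq0; apply/eqP.
  set u := mderiv _ _ _; set v := f _; set w := _%:R^-1.
  by set x := _%:C; set y := _%:C; ring.
rewrite complex_normE lecR ComplexField.Normc.normcM normc_real.
rewrite ger0_norm ?invr_ge0 ?exprn_ge0 ?(ltW l0)//.
rewrite ler_pdivlMr ?exprn_gt0// addnC exprD mulrA [_^-1 * _]mulrC.
by rewrite divfK ?expf_neq0 ?gt_eqF// mulrC.
Unshelve. all: by end_near.
Qed.

Lemma mderiv_monomial_0 a b :
  mderiv b (monomial a : cfun R d) 0 = if a == b then (mfact a)%:R else 0.
Proof.
rewrite mderivE -/(pderivs _ _) pderivs_monomial rderivs_rmonomial_0.
by rewrite mcount_mword; case: ifP => _; rewrite ?rmorph_nat ?rmorph0.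
Qed.

(** For the monomial x^a only the term of index a survives, and the two sides of the expansion
    differ by (f(x^a) - mu_a) / lambda^(|a|+d). An error one power of lambda smaller keeps |f(x^a) -
    mu_a| lambda bounded, which forces equality. *)
Lemma moments_unique mu a : has_moments (Kspace d M c) f mu ->
  mu a = f (monomial a).
Proof.
move=> /(_ (monomial a) (mabs a).+1 (carrier_monomial M hM c a)) [C HC].
have ai i : (a i < (mabs a).+1)%N by rewrite ltnS /mabs (bigD1 i)//= leq_addr.
pose b : {ffun 'I_d -> 'I_(mabs a).+1} := [ffun i => Ordinal (ai i)].
have bE : mval b = a by apply/ffunP => i; rewrite !ffunE.
have {}HC : \forall lambda \near +oo, normc (f (monomial a) - mu a) * lambda <= C.
  near=> lambda.
  have l1 : 1 <= lambda by near: lambda; exact: nbhs_pinfty_ge.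
  have l0 : 0 < lambda by exact: lt_le_trans l1.
  have : `| dilate_dual f lambda (monomial a) -
         \sum_(b : {ffun 'I_d -> 'I_(mabs a).+1} | (mabs (mval b) < (mabs a).+1)%N)
           mu (mval b) * mderiv (mval b) (monomial a) 0 /
             ((mfact (mval b))%:R * (lambda ^+ (mabs (mval b) + d))%:C) |
      <= (C / lambda ^+ ((mabs a).+1 + d))%:C by near: lambda.
  rewrite (bigD1 b) /=; last by rewrite bE.
  rewrite big1 ?addr0 => [|b' /andP[_ bb']]; last first.
    rewrite mderiv_monomial_0 ifN ?mulr0 ?mul0r//.
    apply: contraNN bb' => /eqP E; apply/eqP/ffunP => i; apply/val_inj.
    by rewrite ffunE /=; have /ffunP/(_ i) := E; rewrite ffunE => ->.
  (* The factor a! from the derivative of the monomial cancels the a! in the denominator of the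
     expansion. *)
  rewrite bE mderiv_monomial_0 eqxx invfM mulrA mulfK; last first.
    by rewrite -(rmorph_nat (real_complex R)) fmorph_eq0 mfact_neq0.
  rewrite /dilate_dual dilate_monomial (dualZ M hM c f hf); last exact: carrier_monomial.
  rewrite -fmorphV mulrA -rmorphM exprVn -invfM -exprD addnC.
  rewrite mulrC -mulrBl complex_normE lecR ComplexField.Normc.normcM normc_real.
  rewrite ger0_norm ?invr_ge0 ?exprn_ge0 ?(ltW l0)//.
  rewrite addSn exprS invfM mulrA ler_pM2r ?invr_gt0 ?exprn_gt0//.
  by rewrite ler_pdivlMr.
apply/esym/eqP; rewrite -subr_eq0; apply/eqP/ComplexField.Normc.eq0_normc.
apply/eqP; rewrite eq_le normc_ge0 andbT leNgt; apply/negP => n0.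
near +oo_R => lambda.
have : normc (f (monomial a) - mu a) * lambda <= C by near: lambda.
apply/negP; rewrite -ltNge mulrC -ltr_pdivrMr//.
by near: lambda; apply: nbhs_pinfty_gt; exact: num_real.
Unshelve. all: by end_near.
Qed.

End Expansion.

Theorem theorem5 (R : realType) (d : nat) (M : nat -> R)
    (hM : forall p : nat, 0 < M p) (c : uclass)
    (f : cfun R d -> R[i]) (hf : in_dual (Kspace d M c) f) :
  satisfies_MAE (Kspace d M c) f /\
  (forall mu : multi_index d -> R[i],
     has_moments (Kspace d M c) f mu <->
     (forall a : multi_index d, mu a = f (monomial a))).
Proof.
have mom := dual_has_moments M hM c f hf.
split=> [|mu]; first by exists (fun a => f (monomial a)).
split=> [hmu a|muE]; first exact: moments_unique hmu.
by rewrite (_ : mu = fun a => f (monomial a))//; apply/funext.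
Qed.
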